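(* Let $k$ be a positive integer, let $G$ be a $k$-connected graph, and let $W\subseteq V(G)$. Set $U=V(G)\setminus W$ and $w=|W|$. Suppose that $E(G[U])\neq\emptyset$ and $d_G(x)\ge \max\{k+1,w\}$ for every $x\in U$. Then $G[U]$ contains an edge that is $k$-removable in $G$, unless $w=k+1$ and $G[U]$ is a forest such that, for every leaf $u$ of $G[U]$, there exists $z_u\in W$ satisfying \[ N_G(u)=(W\setminus\{z_u\})\cup\{v_u\}, \] where $v_u$ is the unique neighbor of $u$ in $U$.
   Context: All graphs are finite, undirected and simple. A graph is $k$-connected in the usual sense: it has more than $k$ vertices and deleting any set of fewer than $k$ vertices leaves a connected graph. $G[U]$ is the subgraph of $G$ induced by $U$, $d_G(x)$ is the degree of $x$ in $G$, and $N_G(x)$ is the set of neighbors of $x$ in $G$. An edge $e$ of a $k$-connected graph $G$ is $k$-removable if $G-e$ (delete the edge $e$, keep all vertices) is $k$-connected. A leaf of $G[U]$ is a vertex of degree exactly one in $G[U]$. *)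

(* Defs.v *)
From mathcomp Require Import all_boot.
Set Implicit Arguments.
Unset Strict Implicit.
Unset Printing Implicit Defensive.

Record sgraph := SGraph {
  svertex :> finType;
  sedge : rel svertex;
  sedge_sym : symmetric sedge;
  sedge_irrefl : irreflexive sedge }.

Definition neighbors (G : sgraph) (x : G) : {set G} := [set y | sedge x y].

Definition degree (G : sgraph) (x : G) : nat := #|neighbors x|.

Section Induced.
Variables (G : sgraph) (U : {set G}).

Definition induced_type : finType := {x : G | x \in U}.

Definition induced_rel : rel induced_type :=
  fun x y => sedge (val x) (val y).

Lemma induced_sym : symmetric induced_rel.
Proof. by move=> x y; apply: sedge_sym. Qed.

Lemma induced_irrefl : irreflexive induced_rel.
Proof. by move=> x; apply: sedge_irrefl. Qed.

Definition induced : sgraph := SGraph induced_sym induced_irrefl.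

End Induced.

Section DeleteEdge.
Variables (G : sgraph) (x y : G).

Definition del_edge_rel : rel G :=
  fun u v => sedge u v && ([set u; v] != [set x; y]).

Lemma del_edge_sym : symmetric del_edge_rel.
Proof. by move=> u v; rewrite /del_edge_rel sedge_sym setUC. Qed.

Lemma del_edge_irrefl : irreflexive del_edge_rel.
Proof. by move=> u; rewrite /del_edge_rel sedge_irrefl. Qed.

Definition del_edge : sgraph := SGraph del_edge_sym del_edge_irrefl.

End DeleteEdge.

(* The graph without vertices counts as connected; it never arises in
   [k_connected], where fewer than k of the more than k vertices are deleted. *)
Definition connected (G : sgraph) : Prop :=
  forall x y : G, connect (@sedge G) x y.

Definition k_connected (k : nat) (G : sgraph) : Prop :=
  k < #|G| /\ forall S : {set G}, #|S| < k -> connected (induced (~: S)).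

Definition removable_edge (k : nat) (G : sgraph) (x y : G) : Prop :=
  sedge x y /\ k_connected k (del_edge x y).

(* [ucycle] also accepts the empty sequence and, for an edge xy, the sequence
   [:: x; y]; graph cycles are the [ucycle]s with at least 3 vertices. *)
Definition forest (G : sgraph) : Prop :=
  ~ exists c : seq G, 2 < size c /\ ucycle (@sedge G) c.

Definition leaf (G : sgraph) (x : G) : Prop := degree x = 1.

(* Main.v *)
Require Import Defs.
From mathcomp Require Import all_boot.
From mathcomp Require Import zify.

(** If no edge of [G[U]] is removable, then each edge xy of [G[U]] has a
    separation: disjoint sets A, B with x in A and y in B that miss fewer than k
    vertices and have xy as the only edge between them.  Let xy and xz be two
    such edges, with separations (A, B) and (A', B').  Neither y nor z lies in
    both B and B', so no edge joins B :&: B' to A :|: A', while A :&: A' is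
    joined to B :|: B' by xy and xz only.  As x has degree more than k, counting
    forces B and B' to be disjoint and then B' to be smaller than A.  Iterating
    along a cycle is an infinite descent, so [G[U]] is a forest (Mader).  For a
    leaf u with neighbour v and a separation (A, B) of uv, W meets B in at most
    one vertex because d(u) >= |W|, and G[B :\: W] has a vertex x with at most
    one neighbour outside W and the separator; d(x) > k leaves no slack in any
    of these bounds. *)

Set Implicit Arguments.
Unset Strict Implicit.
Unset Printing Implicit Defensive.

Lemma card_disjointU (T : finType) (X Y : {set T}) :
  [disjoint X & Y] -> #|X :|: Y| = #|X| + #|Y|.
Proof. by rewrite -leq_card_setU => /eqP. Qed.

Lemma card_le1_sub1 (T : finType) (x0 : T) (X : {set T}) :
  #|X| <= 1 -> exists x, X \subset [set x].
Proof.
move=> le1; case: (set_0Vmem X) => [->|[x xX]].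
  by exists x0; rewrite sub0set.
exists x; apply/subsetP => y yX; rewrite inE.
by apply/eqP; apply: (card_le1_eqP le1).
Qed.

(** * Separations of an edge in a k-connected graph *)

Section Separations.
Variables (k : nat) (G : sgraph).
Implicit Types (x y z : G) (A B X Y : {set G}).

(** The vertices outside [A] and [B] form the separator; the cardinality clause says without
    subtraction that there are fewer than k of them. The boolean form makes the existence of a
    separation decidable. *)
Definition separation x y A B :=
  [&& x \in A, y \in B, [disjoint A & B], #|G| < #|A| + #|B| + k
    & [forall a in A, forall b in B, sedge a b ==> (a == x) && (b == y)]].

Lemma separationP x y A B :
  reflect [/\ x \in A, y \in B, [disjoint A & B], #|G| < #|A| + #|B| + k
            & forall a b, a \in A -> b \in B -> sedge a b -> a = x /\ b = y]
          (separation x y A B).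
Proof.
apply: (iffP and5P) => -[xA yB dAB cAB eAB]; split=> //.
  move=> a b aA bB ab.
  by have /implyP/(_ ab)/andP[/eqP-> /eqP->] :=
    forall_inP (forall_inP eAB a aA) b bB.
apply/forall_inP => a aA; apply/forall_inP => b bB; apply/implyP => ab.
by have [-> ->] := eAB a b aA bB ab; rewrite !eqxx.
Qed.

Lemma separation_sym x y A B : separation x y A B -> separation y x B A.
Proof.
case/separationP=> xA yB dAB cAB eAB; apply/separationP; split=> //.
- by rewrite disjoint_sym.
- by rewrite (addnC #|B|).
- by move=> a b aB bA; rewrite sedge_sym => ab; have [] := eAB b a bA aB ab.
Qed.

Hypothesis G_conn : k_connected k G.

(** Otherwise the remaining vertices number fewer than k, and deleting them leaves [X] closed under
    adjacency, which cuts [a] off from [b]. *)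
Lemma card_nonadjacent X Y a b : a \in X -> b \in Y -> [disjoint X & Y] ->
  (forall x y, x \in X -> y \in Y -> ~~ sedge x y) -> #|X| + #|Y| + k <= #|G|.
Proof.
move=> aX bY dXY nXY; rewrite leqNgt; apply/negP => ltG.
have cS : #|~: (X :|: Y)| < k.
  have := cardsC (X :|: Y); rewrite card_disjointU //; lia.
have aS : a \in ~: ~: (X :|: Y) by rewrite !inE aX.
have bS : b \in ~: ~: (X :|: Y) by rewrite !inE bY orbT.
have clX : closed (@sedge (induced (~: ~: (X :|: Y))))
                  [pred p | val p \in X].
  apply: intro_closed; first exact: sym_connect_sym (@sedge_sym _).
  move=> p q pq; rewrite !inE => pX.
  have : val q \in X :|: Y by move: (val q) (valP q) => t; rewrite setCK.
  case/setUP=> [//|qY].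
  by case/negP: (nXY _ _ pX qY).
have := closed_connect clX (G_conn.2 _ cS (Sub a aS) (Sub b bS)).
by rewrite !inE !SubK aX (disjointFl dXY bY).
Qed.

Lemma removable_or_separation x y : sedge x y ->
  removable_edge k x y \/ exists A B, separation x y A B.
Proof.
move=> xy.
have [/existsP[A /existsP[B sAB]]|nsep] :=
  boolP [exists A, exists B, separation x y A B]; first by right; exists A, B.
left; split=> //; split; first exact: G_conn.1.
change (forall S : {set G}, #|S| < k ->
  connected (@induced (del_edge x y) (~: (S : {set G})))).
move=> S cS a b; apply/negPn/negP => nab; case/negP: nsep.
pose e := @sedge (@induced (del_edge x y) (~: S)).
(* [A] is the component of [a] in G - xy - S. Only xy can join it to [B], and it does, since [S] is
   too small to separate [G]. Which end lies in [A] is settled last. *)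
pose A : {set G} := [set val p | p in [set p | connect e a p]].
pose B : {set G} := ~: S :\: A.
have aA : val a \in A by apply: imset_f; rewrite inE connect0.
have bB : val b \in B.
  rewrite inE (valP b) andbT; apply/imsetP => -[p].
  rewrite inE => ap /val_inj bp.
  by rewrite bp ap in nab.
have dAB : [disjoint A & B].
  by rewrite -setI_eq0 setIDA setDIl setDv set0I.
have AS : A \subset ~: S by apply/subsetP => _ /imsetP[p _ ->]; apply: valP.
have cAB : #|G| < #|A| + #|B| + k.
  have := cardsC S; have := cardsID A (~: S); rewrite (setIidPr AS) -/B; lia.
have eAB g h : g \in A -> h \in B -> sedge g h -> [set g; h] = [set x; y].
  move=> /imsetP[p]; rewrite inE => ap -> /setDP[hS hA] ph.
  apply/eqP/negPn/negP => ne; case/negP: hA.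
  apply/imsetP; exists (Sub h hS) => //; rewrite inE.
  by apply: connect_trans ap (connect1 _); apply/andP.
have /existsP[g /existsP[h /and3P[gA hB gh]]] :
    [exists g, exists h, [&& g \in A, h \in B & sedge g h]].
  apply: contraLR cAB => nAB; rewrite -leqNgt.
  apply: card_nonadjacent aA bB dAB _ => g h gA hB; apply: contra nAB => gh.
  by apply/existsP; exists g; apply/existsP; exists h; apply/and3P.
have AB g' h' : g' \in A -> h' \in B -> sedge g' h' ->
    (g' = x /\ h' = y) \/ (g' = y /\ h' = x).
  move=> g'A h'B gh'; have := eAB _ _ g'A h'B gh' => E.
  have ne : g' != h' by apply: contraTneq gh' => ->; rewrite sedge_irrefl.
  have : g' \in [set x; y] by rewrite -E set21.
  have : h' \in [set x; y] by rewrite -E set22.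
  by case/set2P=> h'E /set2P[] g'E; move: ne; rewrite g'E h'E ?eqxx; auto.
have AnB g' : g' \in A -> g' \notin B by move=> /(disjointFr dAB) ->.
have [[gx hy]|[gy hx]] := AB g h gA hB gh; subst g h.
  apply/existsP; exists A; apply/existsP; exists B.
  apply/separationP; split=> //.
  move=> g h g'A h'B /(AB _ _ g'A h'B)[//|[gy _]].
  by move: (AnB g g'A); rewrite gy hB.
apply/existsP; exists B; apply/existsP; exists A.
apply: separation_sym; apply/separationP; split=> //.
move=> g h g'A h'B /(AB _ _ g'A h'B)[[gx _]|//].
by move: (AnB g g'A); rewrite gx hB.
Qed.

Lemma separation_descent x y z A B A' B' : k < degree x -> y != z ->
  sedge x y -> sedge x z ->
  separation x y A B -> separation x z A' B' -> #|B'| < #|A|.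
Proof.
move=> degx yz xy xz /separationP[xA yB dAB cAB eAB].
move=> /separationP[xA' zB' dAB' cAB' eAB'].
have yB' : y \notin B'.
  by apply: contraNN yz => yB'; have [_ ->] := eAB' _ _ xA' yB' xy.
have zB : z \notin B.
  by apply: contraNN yz => zB; have [_ ->] := eAB _ _ xA zB xz.
have dI : [disjoint A :&: A' & B :|: B'].
  apply/pred0P => t; rewrite !inE; apply/negP => /andP[/andP[tA tA']].
  by rewrite (disjointFr dAB tA) (disjointFr dAB' tA').
have eI a b : a \in A :&: A' -> b \in B :|: B' -> sedge a b -> a = x.
  case/setIP=> aA aA' /setUP[bB|bB'] ab.
    by have [] := eAB _ _ aA bB ab.
  by have [] := eAB' _ _ aA' bB' ab.
have xI : x \in A :&: A' by apply/setIP.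
have yU : y \in B :|: B' by rewrite inE yB.
(* The extra 1 pays for [x], the only vertex of [A :&: A'] with neighbours in [B :|: B']. Drop it
   and apply [card_nonadjacent]; if nothing remains, count the more than k neighbours of [x], of
   which only [y] and [z] lie in [B :|: B']. *)
have cI : #|A :&: A'| + #|B :|: B'| + k <= #|G|.+1.
  have [I1|[t]] := set_0Vmem (A :&: A' :\ x).
    have Nx : neighbors x \subset
        ~: (A :&: A' :|: (B :|: B')) :|: [set y; z].
      apply/subsetP => t; rewrite inE => xt; rewrite in_setU in_setC.
      have [tU|tU] := boolP (t \in B :|: B').
        apply/orP; right; case/setUP: tU => [tB|tB'].
          by have [_ ->] := eAB _ _ xA tB xt; rewrite set21.
        by have [_ ->] := eAB' _ _ xA' tB' xt; rewrite set22.
      rewrite in_setU (negbTE tU) orbF; apply/orP; left.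
      apply/negP => tI; suff : t \in A :&: A' :\ x by rewrite I1 inE.
      rewrite in_setD1 tI andbT; apply: contraTneq xt => ->.
      by rewrite sedge_irrefl.
    have := subset_leq_card Nx; have := cardsC (A :&: A' :|: (B :|: B')).
    have := (leq_card_setU (~: (A :&: A' :|: (B :|: B'))) [set y; z]).1.
    rewrite (card_disjointU dI) cards2 yz.
    by move: degx; rewrite /degree; clear; lia.
  move=> tI.
  have := card_nonadjacent tI yU.
  have -> : [disjoint A :&: A' :\ x & B :|: B'].
    exact: disjointWl (subsetDl _ _) dI.
  move=> /(_ isT) H; have := cardsD1 x (A :&: A'); rewrite xI.
  suff : #|A :&: A' :\ x| + #|B :|: B'| + k <= #|G| by clear; lia.
  apply: H => a b /setD1P[ax aI] bU; apply: contraNN ax => ab.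
  by apply/eqP; apply: eI ab.
have B0 : B :&: B' = set0.
  have [//|[b bI]] := set_0Vmem (B :&: B'); exfalso.
  have xU : x \in A :|: A' by rewrite inE xA.
  (* Added to [cI], this bounds the sizes of the four sides plus 2k by 2|G| + 1, while the two
     separations force at least 2|G| + 2. *)
  suff : #|A :|: A'| + #|B :&: B'| + k <= #|G|.
    have := cardsUI A A'; have := cardsUI B B'; move: cAB cAB' cI; clear; lia.
  apply: (card_nonadjacent xU bI).
    apply/pred0P => t; rewrite !inE; apply/negP => /and3P[/orP tU tB tB'].
    by case: tU => [tA|tA']; [rewrite (disjointFr dAB tA) in tB
                             |rewrite (disjointFr dAB' tA') in tB'].
  move=> s t sU /setIP[tB tB']; apply/negP => st.
  case/setUP: sU => [sA|sA'].
    by move: yB'; have [_ <-] := eAB _ _ sA tB st; rewrite tB'.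
  by move: zB; have [_ <-] := eAB' _ _ sA' tB' st; rewrite tB.
have := cardsUI B B'; rewrite B0 cards0.
have : 0 < #|A :&: A'| by apply/card_gt0P; exists x.
move: cAB cI; clear; lia.
Qed.

(** * Acyclicity, as the existence of vertices of low degree *)

Definition unremovable (U : {set G}) :=
  forall x y, x \in U -> y \in U -> sedge x y -> exists A B, separation x y A B.

Variable U : {set G}.
Hypothesis U_deg : forall x, x \in U -> k < degree x.
Hypothesis U_sep : unremovable U.

(** Otherwise one can walk in [X] forever without turning back. Each step from x to z reverses the
    separation of xz, so [B'] becomes the side of the current vertex, and by [separation_descent]
    that side keeps shrinking. *)
Lemma ex_low_degree X : X \subset U -> X != set0 ->
  exists2 x, x \in X & #|neighbors x :&: X| <= 1.
Proof.
move=> /subsetP XU /set0Pn[x0 x0X].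
have [/existsP[x /andP[]]|nex] :=
  boolP [exists x, (x \in X) && (#|neighbors x :&: X| <= 1)]; first by exists x.
have two x : x \in X -> exists y z,
    [/\ y != z, y \in X, z \in X, sedge x y & sedge x z].
  move=> xX; have : 1 < #|neighbors x :&: X|.
    rewrite ltnNge; apply: contra nex => le1.
    by apply/existsP; exists x; rewrite xX.
  by case/card_gt1P=> y [z [/setIP[]]]; rewrite inE => xy yX /setIP[];
    rewrite inE => xz zX yz; exists y, z; split.
suff desc m : forall x y A B, x \in X -> y \in X -> sedge x y ->
    separation x y A B -> #|A| <= m -> False.
  have [y [_ [_ yX _ xy _]]] := two _ x0X.
  have [A [B sAB]] := U_sep (XU _ x0X) (XU _ yX) xy.
  by case: (desc _ _ _ _ _ x0X yX xy sAB (leqnn _)).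
elim: m => [|m IHm] x y A B xX yX xy sAB leA.
  have /separationP[xA _ _ _ _] := sAB.
  by move: leA; rewrite leqn0 cards_eq0 => /eqP A0; rewrite A0 inE in xA.
have [z zX /andP[yz xz]] : exists2 z, z \in X & (y != z) && sedge x z.
  have [s [t [st sX tX xs xt]]] := two _ xX.
  have [E|ys] := eqVneq y s; last by exists s => //; rewrite ys.
  by exists t => //; rewrite E st.
have [A' [B' sAB']] := U_sep (XU _ xX) (XU _ zX) xz.
have zx : sedge z x by rewrite sedge_sym.
apply: (IHm _ _ _ _ zX xX zx (separation_sym sAB')).
by rewrite -ltnS; apply: leq_trans leA;
  apply: separation_descent (U_deg (XU _ xX)) yz xy xz sAB sAB'.
Qed.

(** If the vertex found is [v] itself, delete it and seek by induction one that avoids [s], its only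
    possible neighbour: such a vertex is not adjacent to [v], so restoring [v] gives it no new
    neighbour. *)
Lemma ex_low_degree_neq v X : X \subset U -> 1 < #|X| ->
  exists x, [/\ x \in X, x != v & #|neighbors x :&: X| <= 1].
Proof.
have [n] := ubnP #|X|; elim: n v X => // n IHn v X ltX XU X1.
have X0 : X != set0 by rewrite -card_gt0 ltnW.
have [x xX lex] := ex_low_degree XU X0.
have [E|xv] := eqVneq x v; last by exists x.
subst x; have cX := cardsD1 v X; rewrite xX in cX.
have [le2|gt2] := leqP #|X| 2.
  have /card_gt0P[t] : 0 < #|X :\ v| by lia.
  case/setD1P=> tv tX; exists t; split=> //.
  have tN : t \notin neighbors t :&: X by rewrite !inE sedge_irrefl.
  have : neighbors t :&: X \subset X :\ t.
    by rewrite subsetD1 subsetIr tN.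
  move/subset_leq_card; have := cardsD1 t X; rewrite tX; lia.
have [s sN] := card_le1_sub1 v lex.
have [|||x [/setD1P[xv x_X] xs le1]] := IHn s (X :\ v).
- lia.
- exact: subset_trans (subsetDl _ _) XU.
- lia.
exists x; split=> //; apply: leq_trans le1; apply: subset_leq_card.
apply/subsetP => t /setIP[tN tX]; rewrite in_setI tN in_setD1 tX !andbT /=.
apply: contraNneq xs => tv; rewrite -in_set1; apply: (subsetP sN).
by rewrite in_setI x_X andbT inE sedge_sym -tv; rewrite inE in tN.
Qed.

End Separations.

(** * Leaves, cycles and the exceptional case *)

Lemma leaf_neighbors (k : nat) (G : sgraph) (W : {set G}) (u v : G) :
  k_connected k G ->
  (forall x, x \in ~: W -> maxn k.+1 #|W| <= degree x) ->
  unremovable k (~: W) -> u \in ~: W -> neighbors u :&: ~: W = [set v] ->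
  #|W| = k.+1 /\
  exists2 z, z \in W & neighbors u = (W :\ z) :|: [set v].
Proof.
move=> G_conn U_deg U_sep uU Nu.
have U_degk x : x \in ~: W -> k < degree x.
  by move/U_deg; rewrite geq_max => /andP[].
have /setIP[] : v \in neighbors u :&: ~: W by rewrite Nu set11.
rewrite inE => uv vU.
have [A [B /separationP[uA vB dAB cAB eAB]]] := U_sep _ _ uU vU uv.
have cS : #|~: (A :|: B)| < k.
  have := cardsC (A :|: B); rewrite card_disjointU //; lia.
have NuW : neighbors u \subset (W :\: B) :|: [set v].
  apply/subsetP => t tN; rewrite in_setU in_setD in_set1.
  have [tW|tW] := boolP (t \in W); last first.
    have : t \in neighbors u :&: ~: W by rewrite in_setI tN in_setC.
    by rewrite Nu inE => ->; rewrite orbT.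
  rewrite andbT; apply/orP; left; apply/negP => tB; rewrite inE in tN.
  have [_ tv] := eAB _ _ uA tB tN.
  by move: vU; rewrite inE -tv tW.
have [x [xU xle]] : exists x, x \in ~: W /\ degree x <= k + #|W :&: B|.
  suff [x [t [xU xB Nx]]] : exists x t, [/\ x \in ~: W, x \in B &
      neighbors x \subset ~: (A :|: B) :|: (W :&: B) :|: [set t]].
    exists x; split=> //; have := subset_leq_card Nx.
    have := (leq_card_setU (~: (A :|: B) :|: (W :&: B)) [set t]).1.
    have := (leq_card_setU (~: (A :|: B)) (W :&: B)).1.
    rewrite cards1 /degree; move: cS; clear; lia.
  have NB x t : x \in B -> t \in neighbors x -> t \in A -> x = v /\ t = u.
    move=> xB; rewrite inE sedge_sym => tx tA.
    by have [-> ->] := eAB _ _ tA xB tx.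
  have vX : v \in B :&: ~: W by apply/setIP.
  (* If [v] is alone in [B :&: ~: W], the one extra neighbour is [u]. Otherwise an [x] other than
     [v] has no neighbour in [A], and the extra one lies in [B :&: ~: W]. *)
  have [le1|gt1] := leqP #|B :&: ~: W| 1.
    exists v, u; split=> //; apply/subsetP => t tN.
    rewrite !in_setU in_setC in_setU in_setI in_set1.
    have [tA|tA] := boolP (t \in A).
      by have [_ ->] := NB _ _ vB tN tA; rewrite eqxx orbT.
    have [tB|//] := boolP (t \in B); have [//|tW] := boolP (t \in W).
    have tX : t \in B :&: ~: W by rewrite !inE tB.
    move: tN; rewrite (card_le1_eqP le1 t v tX vX).
    by rewrite inE sedge_irrefl.
  have [x [/setIP[xB xU] xv le1]] :=
    ex_low_degree_neq G_conn U_degk U_sep v (subsetIr _ _) gt1.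
  have [t sN] := card_le1_sub1 x le1.
  exists x, t; split=> //; apply/subsetP => s sN'.
  rewrite in_setU.
  have [sX|sX] := boolP (s \in B :&: ~: W).
    by rewrite (subsetP sN) ?orbT // in_setI sN'.
  have sA : s \notin A.
    by apply: contraNN xv => sA; have [-> _] := NB _ _ xB sN' sA.
  move: sX; rewrite !inE (negbTE sA) /=.
  by case: (s \in B); case: (s \in W).
have := U_deg _ xU; have := U_deg _ uU; rewrite !geq_max.
move=> /andP[ku wu] /andP[kx wx].
have := subset_leq_card NuW; have := (leq_card_setU (W :\: B) [set v]).1.
have := cardsID B W; rewrite cards1.
rewrite /degree in ku wu kx wx xle *.
move: #|neighbors x| kx wx xle => dx kx wx xle cW cU cN.
(* [NuW] and |W| <= d(u) give |W :&: B| <= 1, and k < d(x) makes it 1. Then |W| <= d(x) <= k + 1 <=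
   d(u) <= |W|, so equality holds throughout. *)
have [WB1 Wk cNu] : [/\ #|W :&: B| = 1, #|W| = k.+1
    & #|(W :\: B) :|: [set v]| <= #|neighbors u|].
  by move: ku wu kx wx xle cW cU cN; clear; split; lia.
split=> //.
have /cards1P[z WBz] : #|W :&: B| == 1 by rewrite WB1.
exists z; first by have : z \in W :&: B; [rewrite WBz set11 | case/setIP].
have -> : W :\ z = W :\: B by rewrite -WBz setDIr setDv set0U.
by apply/eqP; rewrite eqEcard NuW.
Qed.

(** On the vertex set of a cycle every vertex has two neighbours, its successor and its predecessor,
    against [ex_low_degree]. *)
Lemma unremovable_forest (k : nat) (G : sgraph) (U : {set G}) :
  k_connected k G -> (forall x, x \in U -> k < degree x) ->
  unremovable k U -> forest (induced U).
Proof.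
move=> G_conn U_deg U_sep [c [c2 /andP[cyc uc]]].
have XU : [set val p | p in c] \subset U.
  by apply/subsetP => _ /imsetP[p _ ->]; apply: valP.
have [p0 p0c] : exists p, p \in c.
  by case: c c2 {cyc uc XU} => // p c; exists p; rewrite mem_head.
have X0 : [set val p | p in c] != set0.
  by apply/set0Pn; exists (val p0); apply: imset_f.
have [_ /imsetP[p pc ->]] := ex_low_degree G_conn U_deg U_sep XU X0.
rewrite leqNgt => /negP; apply; apply/card_gt1P.
have [i [r rE]] : exists i r, rot i c = p :: r.
  by case/rot_to: pc => i r; exists i, r.
exists (val (next c p)), (val (prev c p)); split.
- apply/setIP; split; first by rewrite inE; apply: (next_cycle cyc pc).
  by rewrite imset_f // mem_next.
- apply/setIP; split; last by rewrite imset_f // mem_prev.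
  by rewrite inE sedge_sym; apply: (prev_cycle cyc pc).
(* If the two agreed, [p] would be its own second successor, which fails on a cycle of at least
   three vertices. *)
rewrite (inj_eq val_inj); apply/eqP => /(congr1 (next c)).
rewrite (next_prev uc) -!(next_rot i uc) rE.
have := c2; rewrite -(size_rot i) rE.
have : uniq (p :: r) by rewrite -rE rot_uniq.
case: r {rE} => [|a [|b r]] //=.
rewrite !inE !negb_or eqxx => /andP[/and3P[pa pb _] _] _.
by rewrite eq_sym (negbTE pa) eqxx => bp; rewrite bp eqxx in pb.
Qed.

Theorem theorem2p2 (k : nat) (G : sgraph) (W : {set G})
    (k_gt0 : 0 < k)
    (G_conn : k_connected k G)
    (U_edge : exists x y : induced (~: W), sedge x y)
    (U_deg : forall x : G, x \in ~: W -> maxn k.+1 #|W| <= degree x) :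
  (exists x y : induced (~: W),
     sedge x y /\ removable_edge k (val x) (val y))
  \/
  (#|W| = k.+1 /\
   forest (induced (~: W)) /\
   forall u : induced (~: W), leaf u ->
     exists2 z : G, z \in W &
       exists2 v : induced (~: W), neighbors u = [set v] &
         neighbors (val u) = (W :\ z) :|: [set val v]).
Proof.
have U_degk x : x \in ~: W -> k < degree x.
  by move/U_deg; rewrite geq_max => /andP[].
have [/existsP[x /existsP[y /andP[xy /negP nsep]]]|all_sep] := boolP
    [exists x : induced (~: W), exists y : induced (~: W), sedge x y &&
      ~~ [exists A, exists B, separation k (val x) (val y) A B]].
  left; exists x, y; split=> //.
  have [//|[A [B sAB]]] := removable_or_separation G_conn xy.
  by case: nsep; apply/existsP; exists A; apply/existsP; exists B.
have U_sep : unremovable k (~: W).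
  move=> x y xU yU xy.
  have [/existsP[A /existsP[B sAB]]|nsep] :=
    boolP [exists A, exists B, separation k x y A B]; first by exists A, B.
  case/negP: all_sep; apply/existsP; exists (Sub x xU).
  by apply/existsP; exists (Sub y yU); rewrite nsep andbT.
right.
(* Without the isolated vertices, at most one neighbour means exactly one, as [X] contains all
   neighbours in [~: W] of its members. This yields an actual leaf, from which |W| = k + 1
   follows. *)
pose X := [set x in ~: W | neighbors x :&: ~: W != set0].
have [x xU xN] : exists2 x, x \in ~: W & #|neighbors x :&: ~: W| = 1.
  have XU : X \subset ~: W by apply/subsetP => x; rewrite inE => /andP[].
  have X0 : X != set0.
    have [x [y xy]] := U_edge; apply/set0Pn; exists (val x).
    rewrite in_set (valP x); apply/set0Pn; exists (val y).
    by rewrite in_setI (valP y) inE andbT.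
  have [x] := ex_low_degree G_conn U_degk U_sep XU X0.
  rewrite inE => /andP[xU xN] le1; exists x => //.
  apply/eqP; rewrite eqn_leq card_gt0 xN andbT; apply: leq_trans le1.
  apply: subset_leq_card; apply/subsetP => y /setIP[yN yU].
  rewrite in_setI yN in_set yU; apply/set0Pn; exists x.
  by rewrite in_setI xU inE sedge_sym; rewrite inE in yN; rewrite yN.
have /eqP/cards1P[v Nx] := xN.
have [Wk _] := leaf_neighbors G_conn U_deg U_sep xU Nx.
split=> //; split; first exact: unremovable_forest G_conn U_degk U_sep.
move=> u /eqP/cards1P[w Nu].
have NuU : neighbors (val u) :&: ~: W = [set val w].
  apply/setP => t; rewrite in_set1; apply/setIP/eqP => [[tN tU]|->].
    have : Sub t tU \in neighbors u by move: tN; rewrite !inE.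
    by rewrite Nu inE => /eqP <-.
  split; last exact: valP.
  by have : w \in neighbors u; [rewrite Nu set11 | rewrite !inE].
have [_ [z zW Nz]] := leaf_neighbors G_conn U_deg U_sep (valP u) NuU.
by exists z => //; exists w.
Qed.
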